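(* Let $g$ be any connected undirected graph with $n$ processors and diameter $diam(g)$, with unique identifiers in $\{0,\dots,n-1\}$. The stabilization time of the protocol $\mathcal{EMSS}$ for $spec_{EM}$ satisfies $temps\_stab(\mathcal{EMSS},ds)\le \lceil diam(g)/2\rceil$ under the synchronous daemon, and $temps\_stab(\mathcal{EMSS},did)\in O(diam(g)\cdot n^3)$ under the unfair distributed daemon.
   Context: Model (state model with shared variables): a distributed system is a connected undirected graph $g=(V,E)$ whose vertices are processors and edges are communication links; $vois(v)$ is the set of neighbours of $v$; $n=|V|$; $diam(g)$ is the diameter of $g$. Each processor $v$ has a unique identity $id_v\in\{0,\dots,n-1\}$. The state of a processor is the value of its variables; a configuration is the tuple of all processor states. A protocol is a set of rules $\langle guard\rangle \to \langle action\rangle$, where the guard is a predicate on the state of the processor and of its neighbours and the action updates the processor's own state. A processor is enabled if one of its guards is true. In a step, a daemon selects a nonempty subset of the enabled processors, and each selected processor atomically executes the action of a true guard, all selected processors reading the configuration at the beginning of the step. An execution is a maximal sequence of configurations linked by steps. The unfair distributed daemon $did$ imposes no constraint on the (nonempty) selected set. The synchronous daemon $ds$ selects all enabled processors at every step. Self-stabilization and stabilization time: a protocol $\pi$ is self-stabilizing for $spec$ under daemon $d$ if, from any configuration, every execution of $\pi$ under $d$ contains a configuration from which every execution of $\pi$ under $d$ satisfies $spec$. $temps\_stab(\pi,d)$ is the worst case, over all initial configurations and all executions of $\pi$ under $d$, of the number of steps until such a configuration is reached. Mutual exclusion: each processor $v$ has a predicate $privilege_v$; $v$ is privileged in a configuration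 $\gamma$ iff $privilege_v$ is true in $\gamma$; if $v$ is privileged in $\gamma$ and is activated during step $(\gamma,\gamma')$, then $v$ executes its critical section during that step. An execution satisfies $spec_{EM}$ if in every configuration at most one processor is privileged (safety) and every processor executes its critical section infinitely often (liveness). Protocol $\mathcal{EMSS}$. Let $K=(2n-1)(diam(g)+1)+2$. Bounded clock: the set $H=\{-n,-n+1,\dots,0,\dots,K-1\}$ with increment $\phi(c)=c+1$ if $c<0$ and $\phi(c)=(c+1)\bmod K$ if $c\ge 0$. For an integer $c$ let $\overline{c}\in\{0,\dots,K-1\}$ with $c\equiv \overline c \pmod K$; $d_K(c,c')=\min\{\overline{c-c'},\overline{c'-c}\}$; $c\le_l c'$ iff $0\le \overline{c'-c}\le 1$. Let $init=\{-n,\dots,0\}$, $init^*=\{-n,\dots,-1\}$, $stab=\{0,\dots,K-1\}$, and $\le_{init}$ the usual order of integers on $init$. Each processor $v$ has one variable $r_v\in H$. Predicates: $privilege_v \equiv (r_v = 2n + 2\,diam(g)\,id_v)$; $correct_v(u)\equiv (r_v\in stab)\wedge(r_u\in stab)\wedge(d_K(r_v,r_u)\le 1)$; $tousCorrects_v\equiv \forall u\in vois(v),\ correct_v(u)$; $etapeNorm_v\equiv tousCorrects_v\wedge \forall u\in vois(v),\ r_v\le_l r_u$; $reInit_v\equiv \neg tousCorrects_v \wedge r_v\notin init$; $etapeConv_v\equiv r_v\in init^*\wedge \forall u\in vois(v),\ (r_u\in init \wedge r_v\le_{init} r_u)$. Rules: $NA:: etapeNorm_v \to r_v:=\phi(r_v)$;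 $CA:: etapeConv_v\to r_v:=\phi(r_v)$; $RA:: reInit_v\to r_v:=-n$. *)

(* Defs.v *)
From HB Require Import structures.
From mathcomp Require Import all_boot all_order all_algebra.
Set Implicit Arguments. Unset Strict Implicit. Unset Printing Implicit Defensive.
Import Order.TTheory GRing.Theory Num.Theory.

Section EMSS.
(* Graph g = (V, adj); vertices are processors; adj is the (symmetric,
   irreflexive) link relation; ident v is the identity id_v in {0..n-1};
   D is the diameter of g. *)
Variables (V : finType) (adj : rel V) (ident : V -> 'I_#|V|) (D : nat).

Definition walk_le (k : nat) (u v : V) : Prop :=
  exists p : seq V, [/\ size p <= k, path adj u p & last u p = v]%N.

(* D is the diameter: every pair is joined by a walk of length <= D (this
   includes connectivity), and some pair has distance exactly >= D. *)
Definition is_diameter : Prop :=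
  (forall u v, walk_le D u v) /\
  (exists u v, forall k, walk_le k u v -> (D <= k)%N).

Local Open Scope ring_scope.

Definition nZ : int := (#|V|)%:Z.
Definition K : nat := ((2 * #|V| - 1) * (D + 1) + 2)%N.
Definition KZ : int := K%:Z.

Definition config := V -> int.

Definition inH (c : int) : bool := (- nZ <= c) && (c <= KZ - 1).
Definition phi (c : int) : int := if c < 0 then c + 1 else ((c + 1) %% KZ)%Z.
Definition cbar (c : int) : int := (c %% KZ)%Z.
Definition dK (c c' : int) : int := Num.min (cbar (c - c')) (cbar (c' - c)).
Definition le_l (c c' : int) : bool := (0 <= cbar (c' - c)) && (cbar (c' - c) <= 1).
Definition in_init (c : int) : bool := (- nZ <= c) && (c <= 0).
Definition in_initS (c : int) : bool := (- nZ <= c) && (c <= -1).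
Definition in_stab (c : int) : bool := (0 <= c) && (c <= KZ - 1).

Definition privilege (g : config) (v : V) : bool :=
  g v == 2%:Z * nZ + 2%:Z * D%:Z * (nat_of_ord (ident v))%:Z.

Definition correct (g : config) (v u : V) : bool :=
  [&& in_stab (g v), in_stab (g u) & dK (g v) (g u) <= 1].
Definition tousCorrects (g : config) (v : V) : bool :=
  [forall u, adj v u ==> correct g v u].
Definition etapeNorm (g : config) (v : V) : bool :=
  tousCorrects g v && [forall u, adj v u ==> le_l (g v) (g u)].
Definition reInit (g : config) (v : V) : bool :=
  ~~ tousCorrects g v && ~~ in_init (g v).
Definition etapeConv (g : config) (v : V) : bool :=
  in_initS (g v) &&
  [forall u, adj v u ==> (in_init (g u) && (g v <= g u))].

Definition enabled (g : config) (v : V) : bool :=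
  [|| etapeNorm g v, etapeConv g v | reInit g v].

Definition rule_exec (g : config) (v : V) (x : int) : Prop :=
  (etapeNorm g v /\ x = phi (g v)) \/
  (etapeConv g v /\ x = phi (g v)) \/
  (reInit g v /\ x = - nZ).

Inductive daemon := ds (* synchronous *) | did (* unfair distributed *).

Definition daemon_ok (d : daemon) (g : config) (S : {set V}) : Prop :=
  match d with
  | ds => S = [set v | enabled g v]
  | did => True
  end.

Definition step (d : daemon) (g : config) (S : {set V}) (g' : config) : Prop :=
  [/\ S != set0, {subset S <= [set v | enabled g v]}, daemon_ok d g S &
      forall v, (v \in S -> rule_exec g v (g' v)) /\ (v \notin S -> g' v = g v)].

Definition terminal (g : config) : Prop := forall v, ~~ enabled g v.

(* A (maximal) execution: configurations c i and selected sets s i.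
   A finite maximal execution ending in a terminal configuration is
   represented by stuttering on that configuration with empty selections. *)
Definition is_execution (d : daemon) (c : nat -> config) (s : nat -> {set V}) : Prop :=
  (forall v, inH (c 0%N v)) /\
  (forall i, step d (c i) (s i) (c i.+1) \/
             [/\ terminal (c i), s i = set0 & c i.+1 = c i]).

(* spec_EM: safety and liveness (critical section = privileged and activated) *)
Definition spec_EM (c : nat -> config) (s : nat -> {set V}) : Prop :=
  (forall i, (#|[set v | privilege (c i) v]| <= 1)%N) /\
  (forall v i, exists j, [/\ (i <= j)%N, privilege (c j) v & v \in s j]).

Definition legitimate (d : daemon) (g : config) : Prop :=
  forall c s, is_execution d c s -> c 0%N = g -> spec_EM c s.

Definition stab_time_le (d : daemon) (T : nat) : Prop :=
  forall c s, is_execution d c s ->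
    exists i, (i <= T)%N /\ legitimate d (c i).

End EMSS.

(* Main.v *)
Require Import Defs.
From HB Require Import structures.
From mathcomp Require Import all_boot all_order all_algebra.
From mathcomp Require Import zify ring.
Set Implicit Arguments. Unset Strict Implicit. Unset Printing Implicit Defensive.
Import Order.TTheory GRing.Theory Num.Theory.

(** Call a configuration a unison when all links are correct.  The clocks of a
    unison lift to integers that differ by at most 1 along each link, hence by
    at most D overall; steps only increment lifted clocks, and a minimal one is
    always enabled.  Privileged values are more than D apart modulo K, so at
    most one processor is privileged, and every clock keeps turning.

    Under the unfair daemon, every reset of w but its first is caused by a
    neighbour waiting at -n after its own reset, so resets propagate in waves,
    one for each processor that resets at least once.  In a wave, the heights
    reached in the climb from -n to 0 differ by at most 1 along the links that
    propagated it, so a wave cannot contain both heights -n and 0, which would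
    require n + 1 processors.  Therefore no processor meets the same wave twice
    and there are at most n^2 resets.  Between two resets, the numbers of NA
    moves of neighbours differ by at most 2 and a processor that made one has
    only correct links, so outside of unison nobody makes more than 2D of them.
    A weighted count of resets, climbing moves and NA moves gives O(D n^3).

    Under the synchronous daemon, a positive clock that is not reset has correct
    links only.  A processor privileged at time i therefore determines, up to
    the distance j, the clocks at distance j at all times up to i - j; two
    privileged processors have a common such neighbour at time i - ceil(D/2),
    which bounds the gap between their clocks. *)

Section EMSS.
Variables (V : finType) (adj : rel V) (ident : V -> 'I_#|V|) (D : nat).
Hypothesis adj_sym : symmetric adj.
Hypotheses (ident_inj : injective ident) (diamD : is_diameter adj D).

Local Open Scope ring_scope.
Local Notation n := (nZ V).
Local Notation Kz := (KZ V D).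
Local Notation phi := (phi V D).
Local Notation inH := (inH V D).
Local Notation correct := (correct D).
Local Notation tousCorrects := (tousCorrects adj D).
Local Notation etapeNorm := (etapeNorm adj D).
Local Notation reInit := (reInit adj D).
Local Notation etapeConv := (etapeConv adj).
Local Notation enabled := (enabled adj D).
Local Notation privilege := (privilege ident D).
Local Notation step := (step adj D).
Local Notation execution := (is_execution adj D).
Local Notation legitimate := (legitimate adj ident D).
Local Notation config := (config V).

Implicit Types (g : config) (u v w : V) (S : {set V}).

(** * Diameter, number of processors and modulus *)

Lemma diam_lt_card : (D < #|V|)%N.
Proof.
case: diamD => _ [u [v far]].
have [p [_ up vp]] := (proj1 diamD) u v.
rewrite -vp in far.
case/shortenP: up far => p' up' uniq_p' _ far.
have Dp' : (D <= size p')%N by apply: far; exists p'.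
have := max_card (mem (u :: p')); rewrite (card_uniqP uniq_p') /=.
by apply: leq_trans.
Qed.

Lemma n_gt0 : 0 < n.
Proof. by have := diam_lt_card; rewrite /nZ; lia. Qed.

Lemma KE : Kz = (2 * n - 1) * (D%:Z + 1) + 2.
Proof.
rewrite /KZ /K /nZ; have := diam_lt_card.
set m := #|V|; move=> Dm.
by nia.
Qed.

Lemma K_gt : 2 * D%:Z + 2 < Kz.
Proof. by rewrite KE; have := diam_lt_card; have := n_gt0; rewrite /nZ; nia. Qed.

(** * The bounded clock *)

Lemma phi_neg x : x < 0 -> phi x = x + 1.
Proof. by rewrite /Defs.phi => ->. Qed.

Lemma phi_top : phi (Kz - 1) = 0.
Proof.
have := K_gt => K_gt; rewrite /Defs.phi ifF; last by lia.
by rewrite subrK modzz.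
Qed.

Lemma phi_mid x : 0 <= x -> x < Kz - 1 -> phi x = x + 1.
Proof.
move=> x0 xK; rewrite /Defs.phi ifF; last by lia.
by rewrite modz_small //; lia.
Qed.

Lemma phiP x : inH x ->
  [\/ x < 0 /\ phi x = x + 1, x = Kz - 1 /\ phi x = 0
    | [/\ 0 <= x, x < Kz - 1 & phi x = x + 1]].
Proof.
have := K_gt => K_gt; rewrite /Defs.inH => xH.
have [x0|x0] := ltP x 0; first by constructor 1; rewrite phi_neg.
have [->|xK] := eqVneq x (Kz - 1); first by constructor 2; rewrite phi_top.
by constructor 3; split; [| lia | apply: phi_mid; lia].
Qed.

Lemma cbarE x : - Kz < x -> x < Kz -> cbar V D x = if 0 <= x then x else x + Kz.
Proof.
move=> xl xr; rewrite /cbar; case: ifP => x0; first by rewrite modz_small; lia.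
by rewrite -(modzDr x) modz_small //; lia.
Qed.

Lemma correctP g v u :
  correct g v u <->
  [/\ 0 <= g v <= Kz - 1, 0 <= g u <= Kz - 1 &
      [\/ -1 <= g v - g u <= 1, g v - g u = Kz - 1 | g u - g v = Kz - 1]].
Proof.
have := K_gt => K_gt; rewrite /Defs.correct /in_stab /dK.
split.
  case/and3P => v_stab u_stab; rewrite !cbarE; try lia.
  move=> d; split => //.
  have [?|?] := boolP (-1 <= g v - g u <= 1); first by constructor 1.
  have [?|?] := eqVneq (g v - g u) (Kz - 1); first by constructor 2.
  by constructor 3; move: d; case: ifP; case: ifP; lia.
case=> v_stab u_stab d; rewrite v_stab u_stab /= !cbarE; try lia.
by case: d => d; case: ifP; case: ifP; lia.
Qed.

Lemma correct_sym g v u : correct g v u -> correct g u v.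
Proof.
by move/correctP=> [? ? d]; apply/correctP; split => //; case: d => d;
  [constructor 1; lia | constructor 3 | constructor 2].
Qed.

Lemma le_lP x y : 0 <= x <= Kz - 1 -> 0 <= y <= Kz - 1 ->
  le_l V D x y <-> [\/ y = x, y = x + 1 | x = Kz - 1 /\ y = 0].
Proof.
have := K_gt => K_gt xK yK; rewrite /le_l cbarE; try lia.
split.
  case: ifP => yx d; last by constructor 3; split; lia.
  by have [?|?] := eqVneq y x; [constructor 1 | constructor 2; lia].
by case; case: ifP; lia.
Qed.

Lemma forall_adjP (P : pred V) v :
  reflect (forall u, adj v u -> P u) [forall u, adj v u ==> P u].
Proof. by apply: (iffP forallP) => H u; [move/implyP: (H u) | apply/implyP/H]. Qed.

Lemma etapeNormP g v :
  etapeNorm g v <-> (forall u, adj v u -> correct g v u /\ le_l V D (g v) (g u)).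
Proof.
split.
  by case/andP => /forall_adjP ok /forall_adjP le u vu; split; [exact: ok | exact: le].
by move=> H; apply/andP; split; apply/forall_adjP => u /H [].
Qed.

Definition next g v : int := if reInit g v then - n else phi (g v).

Lemma reInit_pos g v : inH (g v) -> reInit g v -> 0 < g v.
Proof. by rewrite /Defs.inH => vH /andP [_]; rewrite /in_init; lia. Qed.

(** NA and CA share the same update and each of their guards excludes that of RA, so the action is
    deterministic. *)
Lemma rule_execE g v x : rule_exec adj D g v x -> x = next g v.
Proof.
rewrite /next; case=> [[/andP [ok _] ->]|[[/andP [vi _] ->]|[-> ->//]]].
  by rewrite /Defs.reInit ok.
rewrite ifF //; apply/negP => /andP [_]; move: vi; rewrite /in_initS /in_init; lia.
Qed.

Lemma stepE d g S g' : step d g S g' ->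
  (forall v, v \in S -> enabled g v) /\
  (forall v, g' v = if v \in S then next g v else g v).
Proof.
case=> _ sub _ H; split => [v vS|v]; first by have := sub v vS; rewrite inE.
by case: ifPn => vS; [exact/rule_execE/(proj1 (H v)) | exact: (proj2 (H v))].
Qed.

Lemma next_inH g v : inH (g v) -> inH (next g v).
Proof.
have := K_gt; have := n_gt0; rewrite /next => ? ? vH.
case: ifP => _; first by rewrite /Defs.inH; lia.
by case: (phiP vH) => [[? ->]|[? ->]|[? ? ->]]; move: vH; rewrite /Defs.inH; lia.
Qed.

Lemma step_inH d g S g' :
  step d g S g' -> (forall v, inH (g v)) -> forall v, inH (g' v).
Proof. by case/stepE => _ gE gH v; rewrite gE; case: ifP => // _; apply: next_inH. Qed.

Lemma execution_inH d c s : execution d c s -> forall i v, inH (c i v).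
Proof.
case=> c0 next; elim=> [//|i IH] v.
by case: (next i) => [/step_inH H|[_ _ ->]]; [apply: H | apply: IH].
Qed.

Lemma execution_shift d c s k :
  execution d c s -> execution d (fun i => c (k + i)%N) (fun i => s (k + i)%N).
Proof.
move=> ex; split=> [v|i]; first exact: (execution_inH ex).
by rewrite addnS; apply: (proj2 ex).
Qed.

Lemma enabled_norm g v :
  enabled g v -> ~~ reInit g v -> 0 <= g v -> etapeNorm g v.
Proof.
case/or3P=> [//|/andP [vi _]|->//] _; move: vi; rewrite /in_initS; lia.
Qed.

Lemma enabled_conv g v u : inH (g v) ->
  enabled g v -> adj v u -> g v < 0 -> in_init V (g u) && (g v <= g u).
Proof.
move=> vH + vu v0; case/or3P=> [/etapeNormP/(_ u vu) [/correctP [? _ _] _]||].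
- by lia.
- by case/andP => _ /forall_adjP/(_ u vu).
- by move/(reInit_pos vH); lia.
Qed.

(** * Unison and lifted clocks *)

Definition unison g : bool := [forall v, in_stab V D (g v) && tousCorrects g v].

Lemma unisonP g :
  reflect (forall v, 0 <= g v <= Kz - 1 /\ forall u, adj v u -> correct g v u)
          (unison g).
Proof.
apply: (iffP forallP) => H v.
  by have /andP [? /forall_adjP ?] := H v.
by have [? ?] := H v; apply/andP; split=> //; apply/forall_adjP.
Qed.

(** A lift along the reduction modulo [K]. The link bound is one-sided because [adj] is
    symmetric. *)
Definition lifts (L : V -> int) g : Prop :=
  [/\ forall v, 0 <= g v <= Kz - 1, forall v, exists q, g v = L v + q * Kz
    & forall u v, adj u v -> L v <= L u + 1].

Lemma mulK_small q : - (2 * Kz) < q * Kz < 2 * Kz -> [\/ q = -1, q = 0 | q = 1].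
Proof.
have := K_gt => K_gt qK.
have [ql qr] : q < 2 /\ -2 < q by nia.
have [?|?] := eqVneq q (-1); first by constructor 1.
by have [?|?] := eqVneq q 0; [constructor 2 | constructor 3; lia].
Qed.

Lemma walk_mod g u v k : unison g -> walk_le adj k u v ->
  exists e q, -k%:Z <= e <= k%:Z /\ g v = g u + e + q * Kz.
Proof.
move=> /unisonP uni [p [+ + <-]].
elim: p u k => [|w p IH] u k /=; first by exists 0, 0; lia.
case: k => // k pk /andP [uw wp].
have [e [q [ek ->]]] := IH w k pk wp.
have [_ /(_ w uw) /correctP [_ _ [d|d|d]]] := uni u.
- by exists (e + (g w - g u)), q; lia.
- by exists (e + 1), (q - 1); lia.
- by exists (e - 1), (q + 1); lia.
Qed.

(* The walks from a root have length at most [D] and [2 * D + 1 < K], so the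
   representatives of [g v - g root] in [-D, D] fit together along every edge. *)
Lemma unison_lift g : unison g -> exists L, lifts L g.
Proof.
move=> uni; have /unisonP uni' := uni; have := K_gt => K_gt.
case: (diamD) => walk [r _].
have /fin_all_exists [e eP] v := walk_mod uni (walk r v).
have {}eP v : -D%:Z <= e v <= D%:Z /\ exists q, g v = g r + e v + q * Kz.
  by have [q []] := eP v; split => //; exists q.
exists (fun v => g r + e v); split=> [v|v|u v uv]; first by have [] := uni' v.
  by have [_ [q ->]] := eP v; exists q.
have [eu [qu guE]] := eP u; have [ev [qv gvE]] := eP v.
have [_ /(_ v uv) /correctP [_ _ d]] := uni' u.
have E : g u - g v = e u - e v + (qu - qv) * Kz by rewrite guE gvE; lia.
have [] : [\/ qu - qv = -1, qu - qv = 0 | qu - qv = 1].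
- by apply: mulK_small; case: d => d; lia.
- by move=> qE; rewrite qE in E; case: d; lia.
- by move=> qE; rewrite qE in E; case: d; lia.
- by move=> qE; rewrite qE in E; case: d; lia.
Qed.

Lemma lifts_edge L g u v : lifts L g -> adj u v ->
  -1 <= L u - L v <= 1 /\
  [\/ g u - g v = L u - L v, g u - g v = L u - L v + Kz | g u - g v = L u - L v - Kz].
Proof.
case=> gK gL Luv uv; have := K_gt => K_gt.
have vu : adj v u by rewrite adj_sym.
have := Luv _ _ uv; have := Luv _ _ vu => d1 d2; split; first lia.
have [qu guE] := gL u; have [qv gvE] := gL v.
have gu := gK u; have gv := gK v.
have E : g u - g v = L u - L v + (qu - qv) * Kz by rewrite guE gvE; lia.
have [qE|qE|qE] : [\/ qu - qv = -1, qu - qv = 0 | qu - qv = 1].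
- by apply: mulK_small; lia.
- by constructor 3; rewrite E qE; lia.
- by constructor 1; rewrite E qE; lia.
- by constructor 2; rewrite E qE; lia.
Qed.

Lemma lifts_correct L g u v : lifts L g -> adj u v -> correct g u v.
Proof.
move=> LG uv; have := K_gt => K_gt; have [d E] := lifts_edge LG uv.
case: LG => gK _ _; apply/correctP; split=> //.
have := gK u; have := gK v => gv gu.
have [?|?] := boolP (-1 <= g u - g v <= 1); first by constructor 1.
have [?|?] := eqVneq (g u - g v) (Kz - 1); first by constructor 2.
by constructor 3; case: E; lia.
Qed.

Lemma lifts_le_l L g u v : lifts L g -> adj u v ->
  le_l V D (g u) (g v) <-> L u <= L v.
Proof.
move=> LG uv; have := K_gt => K_gt; have [d E] := lifts_edge LG uv.
case: LG => gK _ _; have := gK u; have := gK v => gv gu.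
split=> [/(le_lP gu gv) [] ? | Luv]; try by case: E; lia.
apply/le_lP => //.
have [?|?] := eqVneq (g v) (g u); first by constructor 1.
have [?|?] := eqVneq (g v) (g u + 1); first by constructor 2.
by constructor 3; case: E; lia.
Qed.

Lemma lifts_enabled L g v : lifts L g -> enabled g v ->
  etapeNorm g v /\ forall u, adj v u -> L v <= L u.
Proof.
move=> LG en; have gK : 0 <= g v <= Kz - 1 by case: LG.
have ok : tousCorrects g v by apply/forall_adjP => u; exact: lifts_correct LG.
have norm : etapeNorm g v.
  by apply: enabled_norm => //; [rewrite /Defs.reInit ok | lia].
split=> // u vu; apply/(lifts_le_l LG vu).
by have /etapeNormP/(_ u vu) [] := norm.
Qed.

(** An activated processor is a local minimum of [L], so its increment keeps the bound along links;
    the wrap from [K - 1] to 0 is absorbed by the multiple of [K]. *)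
Lemma lifts_step d L g S g' : lifts L g -> step d g S g' ->
  lifts (fun v => L v + (v \in S)%:Z) g'.
Proof.
move=> LG /stepE [en gE]; have := K_gt => K_gt.
have [gK gL Luv] := LG.
have ok v : tousCorrects g v by apply/forall_adjP => u; exact: lifts_correct LG.
have nextE v : next g v = phi (g v) by rewrite /next /Defs.reInit ok.
have vH v : inH (g v) by have := gK v; have := n_gt0; rewrite /Defs.inH; lia.
split=> [v|v|u v uv].
- have := gK v; rewrite gE nextE; case: ifP => // _ gv.
  by case: (phiP (vH v)) => [[? ->]|[? ->]|[? ? ->]]; lia.
- have [q qE] := gL v; have gv := gK v; rewrite gE nextE; case: ifP => _ /=.
    case: (phiP (vH v)) => [[? _]|[gvE ->]|[? ? ->]]; first lia.
      by exists (q - 1); lia.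
    by exists q; lia.
  by exists q; lia.
- have := Luv _ _ uv; have [vS|_] := boolP (v \in S); last by lia.
  have [_ /(_ u)] := lifts_enabled LG (en v vS).
  by rewrite adj_sym => /(_ uv); case: (u \in S); lia.
Qed.

Lemma lifts_walk L g k u v : lifts L g -> walk_le adj k u v -> L v <= L u + k%:Z.
Proof.
move=> [_ _ Luv] [p [+ + <-]].
elim: p u k => [|w p IH] u k /=; first by lia.
by case: k => // k pk /andP [/Luv ? /(IH w k pk)]; lia.
Qed.

Lemma lifts_some_enabled L g : lifts L g -> exists v, enabled g v.
Proof.
case: (diamD) => _ [r _] LG.
have [v _ vmin] := Order.TotalTheory.arg_minP (P := xpredT) L (erefl true : xpredT r).
exists v; apply/or3P; constructor 1; apply/etapeNormP => u vu.
by split; [exact: lifts_correct LG vu | apply/(lifts_le_l LG vu)/vmin].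
Qed.

Lemma terminalF g v : terminal adj D g -> enabled g v -> False.
Proof. by move=> /(_ v) /negP. Qed.

Lemma lifts_execution d c s L : execution d c s -> lifts L (c 0%N) ->
  forall i, lifts (fun v => L v + (\sum_(j < i) (v \in s j)%:Z)) (c i) /\ s i != set0.
Proof.
move=> ex L0.
have Li i : lifts (fun v => L v + (\sum_(j < i) (v \in s j)%:Z)) (c i).
  elim: i => [|i IH].
    case: L0 => ? cL Luv; split=> // [v|u v uv]; rewrite !big_ord0 !addr0.
      exact: cL.
    exact: Luv.
  case: (proj2 ex i) => [/(lifts_step IH)|[term _ _]]; last first.
    by have [v /(terminalF term)] := lifts_some_enabled IH.
  case=> ? cL Luv; split=> // [v|u v uv]; rewrite !big_ord_recr /= !addrA.
    exact: cL.
  exact: Luv.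
move=> i; split=> //.
case: (proj2 ex i) => [[]//|[term _ _]].
by have [v /(terminalF term)] := lifts_some_enabled (Li i).
Qed.

(** * Safety and liveness in unison *)

(** The modulus is tuned to this: identity [n - 1] gives exactly [K - D - 1], so privileged values
    stay more than [D] apart even across the wrap; [0 < D] makes the spacing [2 * D] exceed [D]. *)
Lemma privilege_gap u v : u != v -> (0 < D)%N ->
  let p w := 2%:Z * n + 2%:Z * D%:Z * (ident w : nat)%:Z in
  [/\ 2 * n <= p u, p u <= Kz - D%:Z - 1, p u - p v <= Kz - D%:Z - 1 &
      p u - p v <= - (2 * D%:Z) \/ 2 * D%:Z <= p u - p v].
Proof.
move=> uv D0 /=; rewrite KE /nZ.
have := ltn_ord (ident u); have := ltn_ord (ident v).
have : (ident u : nat) != (ident v : nat).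
  by apply: contra uv => /eqP/val_inj/ident_inj ->.
move: (nat_of_ord (ident u)) (nat_of_ord (ident v)) => a b; set m := #|V|.
move=> ab bm am; split; [nia|nia|nia|].
have [/ltnW ?|?] := ltnP a b; [left|right]; nia.
Qed.

Lemma lifts_safe L g : lifts L g -> (#|[set v | privilege g v]| <= 1)%N.
Proof.
move=> LG; apply/card_le1_eqP => u v; rewrite !inE /Defs.privilege => /eqP pu /eqP pv.
have [//|uv] := eqVneq u v; have [walk _] := diamD; have := K_gt => K_gt.
have [uv_le vu_le] := (lifts_walk LG (walk v u), lifts_walk LG (walk u v)).
have D0 : (0 < D)%N.
  case: (posnP D) => // D0; move: uv; have [[|w p] [+ _ /= <-]] := walk u v.
    by rewrite eqxx.
  by rewrite D0.
have vu : v != u by rewrite eq_sym.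
have [? ? ? ?] := privilege_gap uv D0; have [? ? ? ?] := privilege_gap vu D0.
case: LG => _ gL _; have [qu guE] := gL u; have [qv gvE] := gL v.
have E : g u - g v = L u - L v + (qu - qv) * Kz by rewrite guE gvE; lia.
have [qE|qE|qE] : [\/ qu - qv = -1, qu - qv = 0 | qu - qv = 1].
- by apply: mulK_small; lia.
- by rewrite qE in E; lia.
- by rewrite qE in E; lia.
- by rewrite qE in E; lia.
Qed.

Lemma sum_activations_ge (s : nat -> {set V}) i : (forall j, s j != set0) ->
  i%:Z <= \sum_v \sum_(j < i) (v \in s j)%:Z.
Proof.
move=> s0; rewrite exchange_big /=.
have -> : i%:Z = \sum_(j < i) 1 by rewrite sumr_const card_ord natz.
apply: ler_sum => j _.
case/set0Pn: (s0 j) => v vs; rewrite (bigD1 v) //= vs.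
by rewrite lerDl; apply: sumr_ge0.
Qed.

(* The lifted clocks stay within [D] of each other while their sum grows at
   every step, so every clock goes through every value infinitely often. *)
Lemma lifts_live d c s L : execution d c s -> lifts L (c 0%N) ->
  forall v i, exists j, [/\ (i <= j)%N, privilege (c j) v & v \in s j].
Proof.
move=> ex L0 v i; have := lifts_execution ex L0 => H; have := K_gt => K_gt.
pose M k w : int := L w + \sum_(j < k) (w \in s j)%:Z.
have Mi k : lifts (M k) (c k) by have [] := H k.
have MS k w : M k.+1 w = M k w + (w \in s k)%:Z by rewrite /M big_ord_recr /= addrA.
have unbounded (m : int) : exists k, m < M k v.
  (* If [v] never passed [m], no [w] could be activated more than [m + D - L w] times, so [B] would
     bound the number of steps. *)
  pose B : int := \sum_w (m + D%:Z - L w).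
  exists `|B|.+1%N; rewrite ltNge; apply/negP => Mm.
  have le w : \sum_(j < `|B|.+1) (w \in s j)%:Z <= m + D%:Z - L w.
    by have := lifts_walk (Mi `|B|.+1%N) (proj1 diamD v w); rewrite [M _ w]/M; lia.
  have := ler_sum (index_enum V) (P := xpredT) (fun w _ => le w).
  have := sum_activations_ge `|B|.+1 (fun j => proj2 (H j)).
  by move=> /le_trans le1 /le1; rewrite -/B; lia.
have mono k k' : (k <= k')%N -> M k v <= M k' v.
  elim: k' => [|k' IH]; first by rewrite leqn0 => /eqP ->.
  by rewrite leq_eqVlt => /predU1P [->//|/IH]; rewrite MS; lia.
set p := 2%:Z * n + 2%:Z * D%:Z * (ident v : nat)%:Z.
have p_stab : 0 <= p <= Kz - 1.
  rewrite /p KE /nZ; have := ltn_ord (ident v); have := diam_lt_card.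
  by move: (nat_of_ord _) => a; set m := #|V|; nia.
(* A lift of the privileged value that is not yet passed at time [i]; the step that first takes [v]
   beyond it activates [v] while privileged. *)
pose m := p + `|M i v| * Kz.
have mi : M i v <= m by rewrite /m; nia.
have exk : exists k, m < M k v by exact: unbounded.
case: (ex_minnP exk) => -[|k] mk kmin.
  by have := mono _ _ (leq0n i); lia.
have ik : (i <= k)%N by rewrite leqNgt; apply/negP => /mono; lia.
have Mk : M k v <= m by rewrite leNgt; apply/negP => /kmin; rewrite ltnn.
have vs : v \in s k by move: mk; rewrite MS; case: (v \in s k) => //; lia.
exists k; split=> //; rewrite /Defs.privilege -/p.
have MkE : M k v = m by move: mk; rewrite MS vs; lia.
have [gK gL _] := Mi k; have := gK v; have [q qE] := gL v.
move: qE; rewrite MkE /m => qE; move=> gv.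
have E : c k v - p = (`|M i v|%:Z + q) * Kz by rewrite qE; lia.
have [|qq|qq|qq] := @mulK_small (`|M i v|%:Z + q).
- by lia.
- by rewrite qq in E; lia.
- by rewrite qq in E; lia.
- by rewrite qq in E; lia.
Qed.

(** * Absence of deadlock and case analysis of moves *)

(** If no reset is enabled, both ends of an incorrect link lie in [init]. A negative minimum can
    then climb; with a nonnegative minimum both ends would be 0, hence correct. *)
Lemma not_unison_enabled g :
  (forall v, inH (g v)) -> ~~ unison g -> exists v, enabled g v.
Proof.
move=> gH nuni; have := K_gt => K_gt.
have [/existsP [v re]|/existsPn nre] := boolP [exists v, reInit g v].
  by exists v; rewrite /Defs.enabled re !orbT.
have init v u : adj v u -> ~~ correct g v u -> in_init V (g v).
  move=> vu nc; have := nre v; rewrite negb_and !negbK => /orP [|//].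
  by move/forall_adjP/(_ u vu); rewrite (negPf nc).
case: (diamD) => _ [r _].
have [v _ vmin] := Order.TotalTheory.arg_minP (P := xpredT) g (erefl true : xpredT r).
have {}vmin u : g v <= g u by exact: vmin.
exists v; apply/or3P; constructor 2; have [v0|v0] := ltP (g v) 0; last first.
  case/negP: nuni; apply/unisonP => u.
  have uH w : 0 <= g w <= Kz - 1 by have := gH w; have := vmin w; rewrite /Defs.inH; lia.
  split=> // w uw; apply/negPn/negP => nc.
  have wu : adj w u by rewrite adj_sym.
  have nc' : ~~ correct g w u by apply: contra nc; exact: correct_sym.
  have := init _ _ uw nc; have := init _ _ wu nc'; have := uH u; have := uH w.
  rewrite /in_init => ? ? ? ?; case/negP: nc; apply/correctP; split=> //.
  by constructor 1; lia.
apply/andP; split; first by have := gH v; rewrite /Defs.inH /in_initS; lia.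
apply/forall_adjP => u vu; rewrite vmin andbT; apply: (init u v); first by rewrite adj_sym.
by apply/negP => /correctP [_ + _]; lia.
Qed.

Lemma some_enabled g : (forall v, inH (g v)) -> exists v, enabled g v.
Proof.
move=> gH; have [/unison_lift [L]|] := boolP (unison g).
  exact: lifts_some_enabled.
exact: not_unison_enabled.
Qed.

Lemma execution_step d c s i : execution d c s -> step d (c i) (s i) (c i.+1).
Proof.
move=> ex; case: (proj2 ex i) => [//|[term _ _]].
by have [v /(terminalF term)] := some_enabled (execution_inH ex i).
Qed.

Variant move_spec g S g' v : Prop :=
| Idle of v \notin S & g' v = g v
| Reset of v \in S & reInit g v & 0 < g v & g' v = - n
| Climb of v \in S & ~~ reInit g v & - n <= g v < 0 & g' v = g v + 1
    & (forall u, adj v u -> - n <= g u <= 0 /\ g v <= g u)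
| Normal of v \in S & ~~ reInit g v & 0 <= g v <= Kz - 1 & g' v = phi (g v)
    & (forall u, adj v u -> correct g v u /\ le_l V D (g v) (g u)).

Lemma moveP d g S g' v : (forall v, inH (g v)) -> step d g S g' -> move_spec g S g' v.
Proof.
move=> gH /stepE [en gE]; have := gH v => vH; have := gE v.
have [vS|vS] := boolP (v \in S); last by constructor 1.
rewrite /next; case: ifPn => re gvE.
  by constructor 2 => //; apply: reInit_pos.
have [v0|v0] := ltP (g v) 0.
  constructor 3 => //; rewrite ?gvE ?phi_neg //.
    by move: vH; rewrite /Defs.inH; lia.
  by move=> u vu; have := enabled_conv vH (en v vS) vu v0; rewrite /in_init => /andP [].
constructor 4 => //; first by move: vH; rewrite /Defs.inH; lia.
exact/etapeNormP/enabled_norm/v0/re/en.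
Qed.

(** A lift of the clock difference local to one link: outside unison there is no global lift. *)
Definition drift g u v (e : int) : Prop :=
  -1 <= e <= 1 /\ (g u - g v = e \/ g u - g v = e + Kz \/ g u - g v = e - Kz).

Lemma correct_drift g u v :
  correct g u v <->
  [/\ 0 <= g u <= Kz - 1, 0 <= g v <= Kz - 1 & exists e, drift g u v e].
Proof.
have := K_gt => K_gt; split=> [/correctP [? ? d]|[? ? [e [e1 d]]]].
  split=> //; case: d => d.
  - by exists (g u - g v); split=> //; left.
  - by exists (-1); split=> //; lia.
  - by exists 1; split=> //; lia.
apply/correctP; split=> //.
have [?|?] := boolP (-1 <= g u - g v <= 1); first by constructor 1.
have [?|?] := eqVneq (g u - g v) (Kz - 1); first by constructor 2.
by constructor 3; lia.
Qed.

Lemma normal_stab g v : 0 <= g v <= Kz - 1 -> 0 <= phi (g v) <= Kz - 1.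
Proof.
move=> gv; have := K_gt => K_gt.
have vH : inH (g v) by rewrite /Defs.inH; have := n_gt0; lia.
by case: (phiP vH) => [[? ->]|[? ->]|[? ? ->]]; lia.
Qed.

(** A correct link carries nonnegative clocks, so without resets its ends move only by NA. A single
    mover is not ahead of the other end and two movers are equal, so the drift stays within 1. *)
Lemma drift_step d g S g' u v e :
  (forall v, inH (g v)) -> step d g S g' -> adj u v ->
  correct g u v -> drift g u v e ->
  ~~ ((u \in S) && reInit g u) -> ~~ ((v \in S) && reInit g v) ->
  drift g' u v (e + (u \in S)%:Z - (v \in S)%:Z) /\ correct g' u v.
Proof.
move=> gH st uv /correctP [gu gv _] [e1 de] nu nv; have := K_gt => K_gt.
have vu : adj v u by rewrite adj_sym.
suff [dr [gu' gv']] : drift g' u v (e + (u \in S)%:Z - (v \in S)%:Z) /\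
    (0 <= g' u <= Kz - 1 /\ 0 <= g' v <= Kz - 1).
  by split=> //; apply/correct_drift; split=> //; exists (e + (u \in S)%:Z - (v \in S)%:Z).
case: (moveP u gH st) => [/negPf uS uE|uS ure|? ? ?|uS _ _ uE /(_ v uv) [_ /(le_lP gu gv) lu]];
  [|by rewrite uS ure in nu|by lia|];
case: (moveP v gH st) => [/negPf vS vE|vS vre|? ? ?|vS _ _ vE /(_ u vu) [_ /(le_lP gv gu) lv]];
  try (by rewrite vS vre in nv); try (by lia);
rewrite uS vS /drift uE vE.
- by rewrite addr0 subr0; split.
- split; last by split=> //; exact: normal_stab.
  by case: (phiP (gH v)) => [[? ->]|[? ->]|[? ? ->]]; case: lv => ?; lia.
- split; last by split=> //; exact: normal_stab.
  by case: (phiP (gH u)) => [[? ->]|[? ->]|[? ? ->]]; case: lu => ?; lia.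
- have E : g v = g u by case: lu => ?; case: lv => ?; lia.
  have e0 : e = 0 by lia.
  by rewrite E e0 subrr; have := normal_stab gu; lia.
Qed.

(** * Reset waves *)

(* Ghost state of an execution: [(rho, v) \in P] records that [v] has taken
   part in the reset wave started by the first reset of [rho], and
   [h rho v <= 0] is the clock of [v] in its climb following that reset,
   frozen at [0] once the climb is over. *)
Definition wave_edge (P : {set V * V}) (h : V -> V -> int) (r : V) : rel V :=
  [rel a b | [&& (r, a) \in P, (r, b) \in P, adj a b & -1 <= h r a - h r b <= 1]].

(** The field [wave_pos] drives the argument: once reset, a processor becomes positive again only
    through NA, with correct links, so a later defect comes from a neighbour reset since and blocked
    at [- n]. The diagonal test in [wave_current] leaves out processors never reset, which may be
    negative from the start. *)
Record waves g (P : {set V * V}) (h : V -> V -> int) : Prop := Waves {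
  wave_root : forall r v, (r, v) \in P -> (r, r) \in P /\ (v, v) \in P;
  wave_height : forall r v, (r, v) \in P ->
    - n <= h r v <= 0 /\ (h r v < 0 -> g v = h r v);
  wave_current : forall v, (v, v) \in P -> g v < 0 ->
    exists2 r, (r, v) \in P & h r v = g v;
  wave_connected : forall r v, (r, v) \in P -> connect (wave_edge P h r) r v;
  wave_pos : forall w a, (w, w) \in P -> adj w a -> 0 < g w ->
    correct g w a \/ (a, a) \in P /\ g a = - n;
  wave_zero : forall w a, (w, w) \in P -> adj w a -> g w = 0 ->
    correct g w a \/ - n <= g a <= 0 }.

Lemma wave_edge_sym P h r : symmetric (wave_edge P h r).
Proof.
move=> a b; rewrite /wave_edge /= [adj b a]adj_sym.
case: ((r, a) \in P); case: ((r, b) \in P) => //=.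
by case: (adj a b) => //=; lia.
Qed.

(** A discrete intermediate value property. *)
Lemma wave_edge_between P h r a b k : connect (wave_edge P h r) a b ->
  h r a <= k <= h r b -> exists x, h r x = k.
Proof.
case/connectP=> p + ->; elim: p a => [|x p IH] a /=; first by exists a; lia.
case/andP=> /and4P [_ _ _ d] xp ak.
have [->|ka] := eqVneq k (h r a); first by exists a.
by apply: IH xp _; lia.
Qed.

(* A wave holding both extreme heights would realise [n + 1] heights. *)
Lemma wave_gap g P h r a b : waves g P h -> (r, a) \in P -> (r, b) \in P ->
  h r a = - n -> h r b <> 0.
Proof.
move=> W ra rb ha hb.
have ab : connect (wave_edge P h r) a b.
  apply: connect_trans (wave_connected W rb).
  by rewrite (sym_connect_sym (wave_edge_sym P h r)) (wave_connected W ra).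
have /fin_all_exists [f fP] (k : 'I_#|V|.+1) : exists x, h r x = (k : nat)%:Z - n.
  apply: (wave_edge_between ab); rewrite ha hb /nZ.
  by move: (nat_of_ord k) (ltn_ord k) => j; lia.
have f_inj : injective f.
  move=> i j E; apply: val_inj => /=; have := fP i; rewrite E fP.
  by move: (nat_of_ord i) (nat_of_ord j) => k k' ?; lia.
by have := leq_card _ f_inj; rewrite card_ord ltnn.
Qed.

Lemma waves0 g : waves g set0 (fun _ _ => 0).
Proof. by split=> [r v|r v|v|r v|w a|w a]; rewrite inE. Qed.

(** A first reset starts the wave of [w] itself. A later one is due to a neighbour at [- n], and [w]
    cannot already be in the wave of that neighbour: its positive clock would give it height 0
    there, against [wave_gap]. *)
Lemma reset_cause g P h w : (forall v, inH (g v)) -> waves g P h -> reInit g w ->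
  exists r, (r, w) \notin P /\
    (r = w \/ (w, w) \in P /\
      exists a, [/\ adj w a, (r, a) \in P, h r a = - n & g a = - n]).
Proof.
move=> gH W re; have w0 := reInit_pos (gH w) re.
have [ww|ww] := boolP ((w, w) \in P); last by exists w; split=> //; left.
have /andP [/forallPn [a]] := re; rewrite negb_imply => /andP [wa nc] _.
have [|[aa ga]] := wave_pos W ww wa w0; first by rewrite (negPf nc).
have [|r ra ha] := wave_current W aa; first by have := n_gt0; lia.
exists r; split; last by right; split=> //; exists a; rewrite ha.
apply/negP => rw; rewrite ga in ha.
have [hw hw0] := wave_height W rw.
apply: (wave_gap W ra rw ha); have [/hw0|] := ltP (h r w) 0; lia.
Qed.

Definition resets g S : {set V} := [set v in S | reInit g v].

Lemma waves_step d g S g' P h :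
  (forall v, inH (g v)) -> step d g S g' -> waves g P h ->
  exists P' h', waves g' P' h' /\ #|P'| = (#|P| + #|resets g S|)%N.
Proof.
move=> gH st W; have := K_gt => K_gt; have := n_gt0 => n_gt0.
have move v := moveP v gH st.
pose R := resets g S.
have R_re v : v \in R -> v \in S /\ reInit g v by rewrite inE => /andP [].
(* [f w] is the wave joined by the reset of [w]; being new for [w], it adds exactly one pair to
   [P]. *)
have /fin_all_exists [f fP] w : exists r, w \in R -> (r, w) \notin P /\
    (r = w \/ (w, w) \in P /\
      exists a, [/\ adj w a, (r, a) \in P, h r a = - n & g a = - n]).
  have [/R_re [_ re]|wR] := boolP (w \in R); last by exists w.
  by have [r rP] := reset_cause gH W re; exists r.
pose P' := P :|: [set (f w, w) | w in R].
(* A negative height is the current clock, so it follows the step; the default [- n] serves the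
   pairs just added. *)
pose h' r v : int := if (r, v) \in P then (if h r v < 0 then g' v else 0) else - n.
have inP' r v : ((r, v) \in P') = ((r, v) \in P) || (v \in R) && (r == f v).
  rewrite inE; congr (_ || _); apply/imsetP/andP => [[w wR [-> ->]]|[vR /eqP ->]].
    by rewrite eqxx.
  by exists v.
have PP' r v : (r, v) \in P -> (r, v) \in P' by rewrite inP' => ->.
have RP' v : v \in R -> (v, v) \in P'.
  move=> vR; have [_ [fE|[vv _]]] := fP v vR; last exact: PP'.
  by rewrite inP' vR fE eqxx orbT.
have Rg' v : v \in R -> g' v = - n /\ 0 < g v.
  case/R_re => vS re; case: (move v) => [|//|_|_]; by rewrite ?vS ?re.
have diagR v : v \notin R -> (v, v) \in P' -> (v, v) \in P.
  by rewrite inP' => /negPf ->; rewrite orbF.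
have keep w a : adj w a -> w \notin R -> a \notin R -> correct g w a -> correct g' w a.
  move=> wa wR aR cwa; have /correct_drift [_ _ [e de]] := cwa.
  have nR v : v \notin R -> ~~ ((v \in S) && reInit g v) by rewrite inE.
  by have [] := drift_step gH st wa cwa de (nR _ wR) (nR _ aR).
exists P', h'; split; last first.
  rewrite cardsU (_ : P :&: _ = set0) ?cards0 ?subn0; last first.
    apply/setP => -[r v]; rewrite !inE; apply/negP => /andP [rv /imsetP [w wR [rE vE]]].
    by have [] := fP w wR; rewrite -rE -vE rv.
  by rewrite card_imset // => v w [].
split.
- move=> r v; rewrite inP' => /orP [rv|/andP [vR /eqP ->]].
    by have [? ?] := wave_root W rv; split; apply: PP'.
  split; last exact: RP'.
  have [_ [->|[_ [a [_ /(wave_root W) [/PP' //]]]]]] := fP v vR; exact: RP'.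
- move=> r v; rewrite inP' /h'; case: ifPn => rv /= rv'; last first.
    by have /andP [/Rg' [? _] _] := rv'; lia.
  have [hv hv0] := wave_height W rv; case: ifP => [hr|]; last lia.
  by have := hv0 hr; case: (move v); lia.
- move=> v vv' v0; have [vR|vR] := boolP (v \in R).
    have [fv _] := fP v vR; exists (f v); first by rewrite inP' vR eqxx orbT.
    by rewrite /h' (negPf fv); have [-> _] := Rg' v vR.
  have vv := diagR v vR vv'.
  have gv0 : g v < 0.
    case: (move v) => [_ <-//|vS re|_ _ + _ _|_ _ gv gE _].
    - by case/negP: vR; rewrite inE vS.
    - by lia.
    - by have := normal_stab gv; lia.
  have [r rv hE] := wave_current W vv gv0.
  by exists r; [exact: PP' | rewrite /h' rv hE gv0].
(* Wave edges persist: by the guard of CA, a height that climbs was at most the height at the other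
   end. *)
- have sub r : subrel (wave_edge P h r) (wave_edge P' h' r).
    move=> a b /and4P [ra rb ab dab]; apply/and4P; split=> //; try exact: PP'.
    have ba : adj b a by rewrite adj_sym.
    rewrite /h' ra rb; have [ha ha0] := wave_height W ra; have [hb hb0] := wave_height W rb.
    have Ha : (if h r a < 0 then g' a else 0) = h r a \/
              (if h r a < 0 then g' a else 0) = h r a + 1 /\ h r a <= h r b.
      case: ifP => [/[dup] hr /ha0 ga|]; last by left; lia.
      case: (move a) => [_ ->|_ _ ? _|_ _ _ -> /(_ b ab) [? ?]|_ _ ? _ _];
        [by left; lia|lia| |lia]; right; split; first lia.
      by have [/hb0|] := ltP (h r b) 0; lia.
    have Hb : (if h r b < 0 then g' b else 0) = h r b \/
              (if h r b < 0 then g' b else 0) = h r b + 1 /\ h r b <= h r a.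
      case: ifP => [/[dup] hr /hb0 gb|]; last by left; lia.
      case: (move b) => [_ ->|_ _ ? _|_ _ _ -> /(_ a ba) [? ?]|_ _ ? _ _];
        [by left; lia|lia| |lia]; right; split; first lia.
      by have [/ha0|] := ltP (h r a) 0; lia.
    by move: Ha Hb; set x := (if _ then _ else _); set y := (if _ then _ else _); lia.
  have conn r v : (r, v) \in P -> connect (wave_edge P' h' r) r v.
    by move/(wave_connected W); apply: connect_sub => a b /sub/connect1.
  move=> r v; rewrite inP' => /orP [/conn //|/andP [vR /eqP rE]].
  have [fv [fE|[vv [a [va ra ha ga]]]]] := fP v vR; first by rewrite rE fE.
  have rv' : (r, v) \in P' by rewrite inP' vR rE eqxx orbT.
  rewrite -rE in fv ra ha.
  (* The newcomer [v] enters beside [a], which stays at [- n] because the clock of [v] was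
     positive. *)
  apply: connect_trans (conn _ _ ra) (connect1 _).
  apply/and4P; split=> //; [exact: PP' | by rewrite adj_sym |].
  have [_ v0] := Rg' v vR.
  have av : adj a v by rewrite adj_sym.
  rewrite /h' ra (negPf fv) ha ifT; last lia.
  by case: (move a) => [_ ->|_ _ ? _|_ _ _ _ /(_ v av)|_ _ ? _ _]; lia.
- move=> w a ww' wa w0; have aw : adj a w by rewrite adj_sym.
  have wR : w \notin R by apply/negP => /Rg' []; lia.
  have ww := diagR w wR ww'.
  have old : correct g w a \/ (a \notin R /\ g' a = - n /\ (a, a) \in P').
    case: (move w) => [_ wE|_ _ _ ?|_ _ ? ? _|_ _ _ _ /(_ a wa) [cwa _]];
      [|by lia|by lia|by left].
    have gw0 : 0 < g w by lia.
    have [|[aa ga]] := wave_pos W ww wa gw0; first by left.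
    right; split; first by apply/negP => /Rg' []; lia.
    split; last exact: PP'.
    by case: (move a) => [_ -> //|_ _ ? _|_ _ _ _ /(_ w aw)|_ _ ? _ _]; lia.
  case: old => [cwa|[_ [? ?]]]; last by right.
  have [aR|aR] := boolP (a \in R); last by left; apply: keep.
  by right; split; [exact: RP' | have [] := Rg' a aR].
- move=> w a ww' wa w0; have aw : adj a w by rewrite adj_sym.
  have wR : w \notin R by apply/negP => /Rg' []; lia.
  have ww := diagR w wR ww'.
  have [aR|aR] := boolP (a \in R); first by right; have [] := Rg' a aR; lia.
  have [/(keep _ _ wa wR aR)|nc] := boolP (correct g w a); first by left.
  right; have old : - n <= g a <= 0.
    case: (move w) => [_ wE|_ _ _ ?|_ _ ? ? /(_ a wa)|_ _ _ _ /(_ a wa) [cwa _]];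
      [|by lia|by lia|by rewrite cwa in nc].
    have gw0 : g w = 0 by lia.
    by have [|//] := wave_zero W ww wa gw0; rewrite (negPf nc).
  case: (move a) => [_ ->//|_ _ ? _|_ _ ? -> _|_ _ _ _ /(_ w aw) [/correct_sym cwa _]];
    [by lia|by lia|by rewrite cwa in nc].
Qed.

(** * Stabilization under the unfair daemon *)

(* [N v] counts the moves of [v] by rule NA since the last reset of any
   processor. *)
Record counts g (N : V -> nat) : Prop := Counts {
  count_stab : forall v, (0 < N v)%N -> 0 <= g v <= Kz - 1;
  count_edge : forall u v, adj u v ->
    correct g u v /\ (exists2 e, drift g u v e & -1 <= e - ((N u)%:Z - (N v)%:Z) <= 1)
    \/ N u = 0%N /\ N v = 0%N }.

Lemma counts0 g : counts g (fun=> 0%N).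
Proof. by split=> // u v _; right. Qed.

(** On a correct link, the drift and the difference of the counters change by the same amount, so
    their offset is preserved. The ends of an incorrect link cannot use NA. A move from a
    nonnegative clock is NA, as resets are excluded. *)
Lemma counts_step d g S g' N :
  (forall v, inH (g v)) -> step d g S g' -> resets g S = set0 -> counts g N ->
  counts g' (fun v => N v + (v \in S) && (0 <= g v)%R)%N.
Proof.
move=> gH st R0 [Nstab Nedge].
have nR v : ~~ ((v \in S) && reInit g v).
  by have := in_set0 v; rewrite -R0 inE => ->.
split=> [v|u v uv].
  have [gv _|gv] := boolP (0 <= g v); last first.
    by rewrite andbF addn0 => /Nstab; lia.
  have gvK : 0 <= g v <= Kz - 1 by have := gH v; rewrite /Defs.inH; lia.
  case: (moveP v gH st) => [_ -> //|vS re|_ _ ?|_ _ _ -> _].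
  - by have := nR v; rewrite vS re.
  - by lia.
  - exact: normal_stab.
have vu : adj v u by rewrite adj_sym.
have [cuv|nc] := boolP (correct g u v); last first.
  have [[cuv]|[Nu Nv]] := Nedge _ _ uv; first by rewrite cuv in nc.
  have idle x y : adj x y -> correct g x y = false -> (x \in S) && (0 <= g x) = false.
    move=> xy ncxy; case: (moveP x gH st) => [/negPf -> //|xS re|_ _ ?|_ _ _ _ /(_ y xy) []].
    - by have := nR x; rewrite xS re.
    - by lia.
    - by rewrite ncxy.
  have ncv : correct g v u = false by apply/negP => /correct_sym; apply/negP.
  by right; rewrite Nu Nv (idle u v uv (negPf nc)) (idle v u vu ncv).
left; have [gu gv [e0 de0]] : [/\ 0 <= g u <= Kz - 1, 0 <= g v <= Kz - 1 &
    exists e, drift g u v e] by apply/correct_drift.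
have [e de eN] : exists2 e, drift g u v e & -1 <= e - ((N u)%:Z - (N v)%:Z) <= 1.
  have [[_ //]|[-> ->]] := Nedge _ _ uv; exists e0 => //.
  by case: de0; lia.
have [de' cuv'] := drift_step gH st uv cuv de (nR u) (nR v).
split=> //; exists (e + (u \in S)%:Z - (v \in S)%:Z) => //.
have [-> ->] : (0 <= g u) = true /\ (0 <= g v) = true by lia.
by rewrite !andbT; lia.
Qed.

Lemma counts_walk g N k u v : counts g N -> walk_le adj k u v -> (N u <= N v + 2 * k)%N.
Proof.
move=> [_ Nedge] [p [+ + <-]].
elim: p u k => [|w p IH] u k /=; first by lia.
case: k => // k pk /andP [/Nedge uw /(IH w k pk) wN].
have : (N u <= N w + 2)%N; last by lia.
by case: uw => [[_ [e [e1 _]]]|[-> ->//]]; lia.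
Qed.

Lemma counts_le g N v : counts g N -> ~~ unison g -> (N v <= 2 * D)%N.
Proof.
move=> C; rewrite leqNgt; apply: contra => Nv.
have N0 u : (0 < N u)%N by have := counts_walk C (proj1 diamD v u); lia.
apply/unisonP => u; split=> [|w uw]; first exact: (count_stab C).
by have [[]//|[]] := count_edge C uw; have := N0 u; lia.
Qed.

(** The climbing moves still due before the clock reaches 0. *)
Definition debt g v : nat := if g v < 0 then `|g v|%N else 0%N.

(* A reset raises the total debt by at most [#|V|] and clears the counters, whose
   sum is at most [2 * D * #|V|]: hence the weight of the first term. *)
Definition potential g (P : {set V * V}) (N : V -> nat) : nat :=
  ((#|V| + 2 * D * #|V| + 1) * (#|V| * #|V| - #|P|) + \sum_v debt g v +
   (2 * D * #|V| - \sum_v N v))%N.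

Definition potential_at g m : Prop :=
  exists P h N, [/\ waves g P h, counts g N & potential g P N = m].

Lemma card_waves (P : {set V * V}) : (#|P| <= #|V| * #|V|)%N.
Proof. by rewrite -card_prod max_card. Qed.

Lemma sum_counts_le g N : counts g N -> ~~ unison g -> (\sum_v N v <= 2 * D * #|V|)%N.
Proof.
move=> C nuni; rewrite mulnC -sum_nat_const; apply: leq_sum => v _.
exact: counts_le C nuni.
Qed.

Lemma sum_mem (A : {set V}) : (\sum_v (v \in A) = #|A|)%N.
Proof. by rewrite -sum1_card [RHS]big_mkcond; apply: eq_bigr => v _; case: (v \in A). Qed.

Lemma potential_decreases d g S g' m :
  (forall v, inH (g v)) -> step d g S g' -> ~~ unison g -> ~~ unison g' ->
  potential_at g m -> exists2 m', (m' < m)%N & potential_at g' m'.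
Proof.
move=> gH st nuni nuni' [P [h [N [W C <-]]]].
have [P' [h' [W' cardP']]] := waves_step gH st W.
have leP' := card_waves P'; have leN := sum_counts_le C nuni.
have [R0|RN0] := eqVneq (resets g S) set0.
  have C' := counts_step gH st R0 C; set N' := (X in counts g' X) in C'.
  exists (potential g' P' N'); last by exists P', h', N'.
  (* Subtraction is truncated in [potential]: this bound, valid because [g'] is not a unison,
     ensures that new NA moves do lower its last term. *)
  have leN' := sum_counts_le C' nuni'.
  have S0 : (0 < #|S|)%N by rewrite card_gt0; case: st.
  have : (\sum_v (debt g' v + N v + (v \in S)) <= \sum_v (debt g v + N' v))%N.
    apply: leq_sum => v _; rewrite /N' /debt.
    case: (moveP v gH st) => [/negPf -> ->|vS re _ _|-> _ ? -> _|-> _ gv -> _].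
    - by rewrite !addn0.
    - by have := in_set0 v; rewrite -R0 inE vS re.
    - by case: ifP; case: ifP; lia.
    - by have := normal_stab gv; case: ifP; case: ifP; lia.
  clearbody N'; rewrite !big_split /= sum_mem.
  rewrite /potential cardP' R0 cards0 addn0.
  move: S0 leN leN'; set w := #|S|; set a := (\sum_v N v)%N.
  set b := (\sum_v N' v)%N; set x := (\sum_v debt g v)%N; set y := (\sum_v debt g' v)%N.
  by move: (_ * (_ - _))%N => z; lia.
exists (potential g' P' (fun=> 0%N)); last first.
  by exists P', h', (fun=> 0%N); split=> //; exact: counts0.
have R_gt0 : (0 < #|resets g S|)%N by rewrite card_gt0.
have : (\sum_v debt g' v <= \sum_v (debt g v + (v \in resets g S) * #|V|))%N.
  apply: leq_sum => v _; rewrite /debt inE.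
  case: (moveP v gH st) => [/negPf -> ->|-> -> ? ->|-> _ ? -> _|-> _ gv -> _].
  - by rewrite addn0.
  - by rewrite mul1n /nZ; case: ifP; lia.
  - by case: ifP; case: ifP; lia.
  - by have := normal_stab gv; case: ifP; lia.
rewrite big_split /= -big_distrl /= sum_mem.
rewrite /potential cardP' big1_eq subn0.
move: leP'; rewrite cardP'.
move: R_gt0 leN; set w := #|resets g S|; set p := #|P|; set k := #|V|.
set a := (\sum_v N v)%N; set x := (\sum_v debt g v)%N; set y := (\sum_v debt g' v)%N.
move=> w0 aD pw yx; set t := (2 * D * k)%N in aD *.
(* The first term loses [(k + t + 1) * w]: new debts cost at most [k * w], clearing the counters at
   most [t], itself at most [t * w], and at least 1 remains. *)
have [z zE] : exists z, (k * k = z + p + w)%N by exists (k * k - p - w)%N; lia.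
have -> : (k * k - (p + w) = z)%N by lia.
have -> : (k * k - p = z + w)%N by lia.
have tw : (t <= t * w)%N by rewrite leq_pmulr.
by rewrite !mulnDr !mulnDl !mul1n; lia.
Qed.

Lemma debt_le g v : inH (g v) -> (debt g v <= #|V|)%N.
Proof. by rewrite /Defs.inH /debt /nZ; case: ifP; lia. Qed.

Definition stab_bound : nat :=
  ((#|V| + 2 * D * #|V| + 1) * (#|V| * #|V|) + #|V| * #|V| + 2 * D * #|V| + 1)%N.

Lemma potential_init g : (forall v, inH (g v)) ->
  exists2 m, (m < stab_bound)%N & potential_at g m.
Proof.
move=> gH; exists (potential g set0 (fun=> 0%N)); last first.
  by exists set0, (fun _ _ => 0), (fun=> 0%N); split; [exact: waves0 | exact: counts0 |].
have : (\sum_v debt g v <= #|V| * #|V|)%N.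
  by rewrite -sum_nat_const; apply: leq_sum => v _; exact: debt_le.
by rewrite /potential /stab_bound cards0 big1_eq !subn0; lia.
Qed.

Lemma converges d c s : execution d c s ->
  exists2 i, (i <= stab_bound)%N & unison (c i).
Proof.
move=> ex; have cH := execution_inH ex.
have H i : (exists2 j, (j <= i)%N & unison (c j)) \/
           ~~ unison (c i) /\ exists2 m, (m + i < stab_bound)%N & potential_at (c i) m.
  elim: i => [|i [[j ji uj]|[nuni [m mi mP]]]].
  - have [u0|nuni] := boolP (unison (c 0%N)); first by left; exists 0%N.
    by right; split=> //; have [m ? ?] := potential_init (cH 0%N); exists m; rewrite ?addn0.
  - by left; exists j => //; exact: leqW.
  - have [ui|nuni'] := boolP (unison (c i.+1)); first by left; exists i.+1.
    right; split=> //.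
    have [m' lt_m mP'] :=
      potential_decreases (cH i) (execution_step i ex) nuni nuni' mP.
    by exists m' => //; lia.
by have [//|[_ [m]]] := H stab_bound; lia.
Qed.

(** Liveness holds from any start, since every execution reaches a unison; only safety remains to be
    timed. *)
Lemma live d c s : execution d c s ->
  forall v i, exists j, [/\ (i <= j)%N, privilege (c j) v & v \in s j].
Proof.
move=> ex v i; have [k _ /unison_lift [L Lk]] := converges ex.
have Lk' : lifts L ((fun i => c (k + i)%N) 0%N) by rewrite addn0.
have [j [ij pj vj]] := lifts_live (execution_shift k ex) Lk' v i.
by exists (k + j)%N; split=> //; lia.
Qed.

Lemma unison_legitimate d g : unison g -> legitimate d g.
Proof.
move=> /unison_lift [L Lg] c s ex cg; split; last exact: live ex.
rewrite -cg in Lg => i; have [Li _] := lifts_execution ex Lg i.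
exact: lifts_safe Li.
Qed.

Lemma did_stab (D_gt0 : (0 < D)%N) :
  stab_time_le adj ident D did (8 * (D * #|V| ^ 3)).
Proof.
move=> c s ex; have [i i_le ui] := converges ex.
exists i; split; last exact: unison_legitimate.
apply: leq_trans i_le _; rewrite /stab_bound.
have := diam_lt_card; set k := #|V| => kD.
have -> : (k ^ 3 = k * k * k)%N by rewrite !expnS expn0 muln1 mulnA.
have k0 : (0 < k)%N by lia.
have e1 : (k * k <= k * k * k)%N by rewrite leq_pmulr.
have e2 : (k <= k * k)%N by rewrite leq_pmulr.
(* The six terms [y], [2 * (D * y)], [x], [x], [2 * D * k] and 1 are at most 1, 2, 1, 1, 2 and 1
   times [D * y]: hence the constant 8. *)
move: e1 e2; set y := (k * k * k)%N; set x := (k * k)%N => e1 e2.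
have -> : ((k + 2 * D * k + 1) * x = y + 2 * (D * y) + x)%N by rewrite /y /x; ring.
have e3 : (y <= D * y)%N by rewrite leq_pmull.
have e4 : (D * k <= D * y)%N by rewrite leq_mul2l; lia.
by lia.
Qed.

(** * Stabilization under the synchronous daemon *)

(** The synchronous daemon fires an enabled reset at once, which would leave the clock at [- n]. *)
Lemma sync_correct c s t v u : execution ds c s -> adj v u ->
  0 < c t v -> 0 < c t.+1 v -> correct (c t) v u.
Proof.
move=> ex vu gv gv'; have := n_gt0 => n_gt0.
have st := execution_step t ex; have [_ _ SE _] := st.
suff /forall_adjP/(_ u vu) : tousCorrects (c t) v by [].
apply/negPn/negP => nok.
have re : reInit (c t) v by rewrite /Defs.reInit nok /in_init; lia.
have vS : v \in s t by rewrite SE inE /Defs.enabled re !orbT.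
by have [_ /(_ v)] := stepE st; rewrite vS /next re; lia.
Qed.

(** A positive clock cannot result from a reset, a climb or the wrap to 0, so each step back in time
    lowers it by 0 or 1. *)
Lemma clock_back d c s i k v : execution d c s -> (k <= i)%N -> k%:Z <= c i v ->
  c i v - k%:Z <= c (i - k)%N v <= c i v.
Proof.
move=> ex; have := n_gt0 => n_gt0.
elim: k => [|k IH] ki civ; first by rewrite subn0; lia.
have /andP [] := IH (ltnW ki) (ltac:(lia)).
rewrite subnS; have : (0 < i - k)%N by lia.
case: (i - k)%N => // t _ /=.
case: (moveP v (execution_inH ex t) (execution_step t ex)).
- by move=> _ ->; lia.
- by move=> _ _ _ ->; lia.
- by move=> _ _ ? ->; lia.
- move=> _ _ gv -> _.
  by case: (phiP (execution_inH ex t v)) => [[? ->]|[? ->]|[? ? ->]]; lia.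
Qed.

(* [x] is [j] links away from a processor whose clock is [p] at time [i]: its
   clock is known during the last [k] steps except the last [j] of them. *)
Definition in_window (c : nat -> config) i k (p : int) x j : Prop :=
  forall t, (i - k <= t)%N -> (t + j <= i)%N ->
    p - k%:Z - j%:Z <= c t x <= p + j%:Z.

(** The link is known to be correct at time [t] when [x] is positive at [t] and [t.+1], so each link
    costs one unit of time. The bounds on [p] keep the window positive and away from the wrap. *)
Lemma in_window_adj c s i k (p : int) x y j : execution ds c s ->
  2 * k%:Z <= p -> p + k%:Z < Kz -> adj x y -> (j < k)%N ->
  in_window c i k p x j -> in_window c i k p y j.+1.
Proof.
move=> ex p_lo p_hi xy jk wx t t_lo t_hi.
have xt : p - k%:Z - j%:Z <= c t x <= p + j%:Z by apply: wx; lia.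
have xt' : p - k%:Z - j%:Z <= c t.+1 x <= p + j%:Z by apply: wx; lia.
have /correctP [_ ?] : correct (c t) x y by apply: sync_correct ex xy _ _; lia.
by case=> ?; lia.
Qed.

Lemma in_window_path c s i k (p : int) x q j : execution ds c s ->
  2 * k%:Z <= p -> p + k%:Z < Kz -> path adj x q -> (j + size q <= k)%N ->
  in_window c i k p x j -> in_window c i k p (last x q) (j + size q).
Proof.
move=> ex p_lo p_hi; elim: q x j => [|y q IH] x j /=; first by rewrite addn0.
case/andP=> xy yq jk wx; rewrite addnS -addSn; apply: IH => //; first by lia.
by apply: in_window_adj ex p_lo p_hi xy _ wx; lia.
Qed.

Lemma in_window0 d c s i k u : execution d c s -> k%:Z <= c i u ->
  in_window c i k (c i u) u 0.
Proof.
move=> ex p_lo t t_lo; rewrite addn0 => t_hi.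
have := @clock_back d c s i (i - t) u ex (leq_subr _ _).
by rewrite subKn //; lia.
Qed.

Lemma walk0 u v : D = 0%N -> u = v.
Proof. by move=> D0; have [[|w p] [+ _ /= <-]] := proj1 diamD u v; rewrite ?D0. Qed.

Lemma safe_diam0 g : D = 0%N -> (#|[set v | privilege g v]| <= 1)%N.
Proof. by move=> D0; apply/card_le1_eqP => u v _ _; apply: walk0. Qed.

Lemma sync_safe c s i : execution ds c s -> (uphalf D <= i)%N ->
  (#|[set v | privilege (c i) v]| <= 1)%N.
Proof.
move=> ex Di; have [D0|D_gt0] := posnP D; first exact: safe_diam0.
have := K_gt => K_gt; have := n_gt0 => n_gt0; have D_lt := diam_lt_card.
have kD : (uphalf D <= D)%N by rewrite leq_uphalf_double -addnn leq_addr.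
have Dk : (D <= 2 * uphalf D)%N by rewrite mul2n -leq_uphalf_double.
set k := uphalf D in Di kD Dk.
apply/card_le1_eqP => u v; rewrite !inE /Defs.privilege => /eqP pu /eqP pv.
have [//|uv] := eqVneq u v; have vu : v != u by rewrite eq_sym.
have [] := privilege_gap uv D_gt0; have [] := privilege_gap vu D_gt0.
rewrite -pu -pv => pv_lo pv_hi pvu _ pu_lo pu_hi puv gap.
have kn : k%:Z < n by rewrite /nZ; lia.
have [p [pD up pv_last]] := proj1 diamD u v.
have adj_uv : D = 1%N -> adj u v.
  case: p pD up pv_last => [|y [|z p]] /=; last by move=> + _ _ D1; rewrite D1.
    by move=> _ _ E; rewrite E eqxx in uv.
  by move=> _ /andP [? _] <-.
(* [x] cuts the walk into pieces of length at most [k], so both privileged clocks control it at time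
   [i - k]. *)
pose x := last u (take k p).
have [up1 xp2] : path adj u (take k p) /\ path adj x (drop k p).
  by apply/andP; rewrite -cat_path cat_take_drop.
have xv : last x (drop k p) = v by rewrite /x -last_cat cat_take_drop.
have s1 : (size (take k p) <= k)%N by rewrite size_take; case: ifP; lia.
have s2 : (size (drop k p) <= k)%N by rewrite size_drop; lia.
have s12 : (size (take k p) + size (drop k p) = size p)%N.
  by rewrite -size_cat cat_take_drop.
pose q := rev (belast x (drop k p)).
have vq : path adj v q.
  rewrite -xv /q rev_path; move: xp2; apply: sub_path => a b; by rewrite adj_sym.
have sq : size q = size (drop k p) by rewrite size_rev size_belast.
have qx : last v q = x.
  by rewrite /q; case: (drop k p) xv => [|y r] //= _; rewrite rev_cons last_rcons.
have wu : in_window c i k (c i u) x (0 + size (take k p)).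
  by apply: in_window_path ex _ _ up1 _ (in_window0 ex _); lia.
have wv : in_window c i k (c i v) x (0 + size q).
  by rewrite -qx; apply: in_window_path ex _ _ vq _ (in_window0 ex _); lia.
have := wu (i - k)%N (leqnn _) (ltac:(lia)).
have := wv (i - k)%N (leqnn _) (ltac:(lia)).
rewrite sq => ? ?.
(* Both windows contain the clock of [x], so the gap is at most [k + D], yet it is at least [2 * D].
   Only [D = 1] survives; there the link between [u] and [v] is still correct at time [i], which
   forbids the gap. *)
have D1 : (D <= k)%N by lia.
have {}D1 : D = 1%N by move: D1; rewrite /k; lia.
have {}adj_uv := adj_uv D1; have adj_vu : adj v u by rewrite adj_sym.
have i0 : (0 < i)%N by move: Di; rewrite /k D1.
have [gu gv] : 0 < c i.-1 u /\ 0 < c i.-1 v.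
  have := @clock_back ds c s i 1 u ex i0; have := @clock_back ds c s i 1 v ex i0.
  by rewrite subn1; lia.
have st := execution_step i.-1 ex; rewrite prednK // in st.
have cuv : correct (c i.-1) u v.
  by apply: sync_correct ex adj_uv _ _; rewrite ?prednK //; lia.
have nR w : 0 < c i w -> ~~ ((w \in s i.-1) && reInit (c i.-1) w).
  by apply: contraL => /andP [wS re]; have [_ ->] := stepE st; rewrite wS /next re; lia.
have /correct_drift [_ _ [e de]] := cuv.
have [nRu nRv] : 0 < c i u /\ 0 < c i v by lia.
have [_ /correctP [_ _]] :=
  drift_step (execution_inH ex i.-1) st adj_uv cuv de (nR _ nRu) (nR _ nRv).
by case=> ?; lia.
Qed.

(** Legitimacy concerns every continuation; gluing one to the prefix lets [sync_safe] apply to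
    it. *)
Lemma execution_cat d c s c' s' k : execution d c s -> execution d c' s' ->
  c' 0%N = c k ->
  execution d (fun i => if (i < k)%N then c i else c' (i - k)%N)
              (fun i => if (i < k)%N then s i else s' (i - k)%N).
Proof.
move=> [c0 cs] [c0' cs'] ck; split=> [v|i]; first by case: ifP => // _; rewrite sub0n.
have [ik|ki] := ltnP i k; last first.
  by rewrite ltnNge (leqW ki) subSn //=; exact: cs'.
have [ik'|ki'] := ltnP i.+1 k; first exact: cs.
have kE : k = i.+1 by apply/eqP; rewrite eqn_leq ki' ik.
by rewrite kE subnn ck kE; exact: cs.
Qed.

Lemma ds_stab : stab_time_le adj ident D ds (uphalf D).
Proof.
move=> c s ex; exists (uphalf D); split=> // c' s' ex' cE.
split; last exact: live ex'.
move=> i; have := sync_safe (execution_cat ex ex' cE) (leq_addr i (uphalf D)).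
by rewrite ltnNge leq_addr addKn.
Qed.

(** For diameter 0 the bound of the theorem is 0, and a lone processor is safe in every
    configuration. *)
Lemma did_stab0 T : D = 0%N -> stab_time_le adj ident D did T.
Proof.
move=> D0 c s ex; exists 0%N; split=> // c' s' ex' _.
by split=> [i|]; [exact: safe_diam0 | exact: live ex'].
Qed.

End EMSS.

Theorem theorem2 :
  (forall (V : finType) (adj : rel V) (ident : V -> 'I_#|V|) (D : nat),
     symmetric adj -> irreflexive adj -> injective ident ->
     is_diameter adj D ->
     stab_time_le adj ident D ds (uphalf D)) /\
  (exists C : nat,
     forall (V : finType) (adj : rel V) (ident : V -> 'I_#|V|) (D : nat),
       symmetric adj -> irreflexive adj -> injective ident ->
       is_diameter adj D ->
       stab_time_le adj ident D did (C * (D * #|V| ^ 3))).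
Proof.
split=> [V adj ident D sym _ inj diamD|]; first exact: ds_stab.
exists 8 => V adj ident D sym _ inj diamD; have [D0|D_gt0] := posnP D.
  exact: did_stab0.
exact: did_stab.
Qed.
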